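(* Let $S=S(p,T)$ be the specific entropy of the mixed ionized gas, i.e. a function on $\{p>0,\,T>0\}$ with $dh=T\,dS+v\,dp$, and let $\eta=\frac{M}{R}S$ be the dimensionless entropy. Then $$\begin{aligned}\eta(p,T)={}&\log\left[\beta\alpha_{A}+(1-\beta)\alpha_{B}\right]+\beta\left[\log\alpha_{A}-2\log(1-\alpha_{A})+\frac{T_{A}}{T}\right]\\&+(1-\beta)\left[\log\alpha_{B}-2\log(1-\alpha_{B})+\frac{T_{B}}{T}\right]\\&+\beta\left(\frac52+\frac{T_{A}}{T}\right)\alpha_{A}+(1-\beta)\left(\frac52+\frac{T_{B}}{T}\right)\alpha_{B}+\mathrm{const.},\end{aligned}$$ where $\alpha_A=\alpha_A(p,T)$ and $\alpha_B=\alpha_B(p,T)$ are the degrees of ionization.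
   Context: Fixed constants: $R,M,\mu_A,\mu_B>0$, $0<\beta<1$, and ionization temperatures $0<T_A<T_B\le 2T_A$. For given pressure $p>0$ and temperature $T>0$, the degrees of ionization $\alpha_A,\alpha_B\in(0,1)$ are determined by Saha's equations $$p=\frac{(1-\alpha_A)(1+\alpha)}{\mu_A\,\alpha_A\,\alpha}T^{5/2}e^{-T_A/T}=\frac{(1-\alpha_B)(1+\alpha)}{\mu_B\,\alpha_B\,\alpha}T^{5/2}e^{-T_B/T},\qquad \alpha:=\beta\alpha_A+(1-\beta)\alpha_B .$$ The specific volume is $v=\frac{RT}{Mp}(1+\alpha)$ and the specific enthalpy is $h=\frac{5RT}{2M}(1+\alpha)+\frac{R}{M}\left[\beta T_A\alpha_A+(1-\beta)T_B\alpha_B\right]$. *)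

(* Defs.v *)
From Stdlib Require Import Reals.
From Coquelicot Require Import Coquelicot.
Open Scope R_scope.

Definition mean_ionization (beta aA aB : R) : R :=
  beta * aA + (1 - beta) * aB.

(* The pressure given by Saha's equation for a species with constant [mu],
   ionization temperature [Ti] and degree of ionization [ai], when the mean
   degree of ionization of the mixture is [a]. *)
Definition saha_pressure (mu Ti ai a T : R) : R :=
  (1 - ai) * (1 + a) / (mu * ai * a) * Rpower T (5 / 2) * exp (- Ti / T).

Definition degrees_of_ionization (muA muB beta TA TB : R)
    (alphaA alphaB : R -> R -> R) : Prop :=
  forall p T : R, 0 < p -> 0 < T ->
    let aA := alphaA p T in
    let aB := alphaB p T in
    let a := mean_ionization beta aA aB in
    0 < aA < 1 /\ 0 < aB < 1 /\
    p = saha_pressure muA TA aA a T /\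
    p = saha_pressure muB TB aB a T.

Definition specific_volume (Rg M beta : R) (alphaA alphaB : R -> R -> R)
    (p T : R) : R :=
  Rg * T / (M * p) * (1 + mean_ionization beta (alphaA p T) (alphaB p T)).

Definition specific_enthalpy (Rg M beta TA TB : R)
    (alphaA alphaB : R -> R -> R) (p T : R) : R :=
  5 * Rg * T / (2 * M) * (1 + mean_ionization beta (alphaA p T) (alphaB p T))
  + Rg / M * (beta * TA * alphaA p T + (1 - beta) * TB * alphaB p T).

(* The identity of differential forms  dh = T dS + v dp  on the open quadrant
   p > 0, T > 0.  If dS = Sp dp + ST dT, the right-hand side is
   (T Sp + v) dp + (T ST) dT; differentials are total (Frechet) ones. *)
Definition is_specific_entropy (h v S : R -> R -> R) : Prop :=
  forall p T : R, 0 < p -> 0 < T ->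
    exists Sp ST : R,
      differentiable_pt_lim S p T Sp ST /\
      differentiable_pt_lim h p T (T * Sp + v p T) (T * ST).

(* Main.v *)
Require Import Defs.
From Stdlib Require Import Reals Lra.
From Coquelicot Require Import Coquelicot.
Open Scope R_scope.

(* With w = p a / (1 + a), where a is the mean degree of ionization, Saha's
   equations give both degrees, hence also a and p, as explicit functions of
   (w, T), and p is strictly increasing in w. Pulling dh = T dS + v dp back
   along the curves t |-> (e^(xt), e^(yt)) of the (w, T)-quadrant expresses the
   derivative of S explicitly; it agrees with the derivative of the right-hand
   side. The differentiability of the degrees of ionization as functions of
   (p, T) is never needed. *)

(** * Saha's equations in the coordinates w, T *)

(** Solution [ai] of (1 - ai) / ai = mu w exp (Ti / T) / T^(5/2), which is Saha's equation once w
    replaces p a / (1 + a). *)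
Definition degree (mu Ti w T : R) : R :=
  / (1 + mu * w * exp (Ti / T) / Rpower T (5 / 2)).

Definition pressure (a w : R) : R := w * (1 + a) / a.

Definition eta (beta TA TB aA aB T : R) : R :=
  ln (beta * aA + (1 - beta) * aB)
  + beta * (ln aA - 2 * ln (1 - aA) + TA / T)
  + (1 - beta) * (ln aB - 2 * ln (1 - aB) + TB / T)
  + beta * (5 / 2 + TA / T) * aA
  + (1 - beta) * (5 / 2 + TB / T) * aB.

(* [auto_derive] leaves eta-expanded derivatives. *)
Lemma Derive_eta (f : R -> R) (t l : R) :
  is_derive f t l -> Derive (fun s => f s) t = l.
Proof. exact (is_derive_unique f t l). Qed.

Lemma Rpower_pos (x y : R) : 0 < Rpower x y.
Proof. apply exp_pos. Qed.

Lemma mean_ionization_bounds (beta aA aB : R) :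
  0 < beta < 1 -> 0 < aA < 1 -> 0 < aB < 1 ->
  0 < mean_ionization beta aA aB < 1.
Proof. unfold mean_ionization; intros; nra. Qed.

Lemma degree_slope_pos (mu Ti T : R) :
  0 < mu -> 0 < mu * exp (Ti / T) / Rpower T (5 / 2).
Proof.
  intros hmu; apply Rdiv_lt_0_compat; [|apply Rpower_pos].
  apply Rmult_lt_0_compat; [exact hmu|apply exp_pos].
Qed.

Lemma degree_eq (mu Ti w T : R) :
  degree mu Ti w T = / (1 + mu * exp (Ti / T) / Rpower T (5 / 2) * w).
Proof. unfold degree; f_equal; unfold Rdiv; ring. Qed.

Lemma degree_bounds (mu Ti w T : R) :
  0 < mu -> 0 < w -> 0 < degree mu Ti w T < 1.
Proof.
  intros hmu hw; rewrite degree_eq.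
  pose proof (Rmult_lt_0_compat _ _ (degree_slope_pos mu Ti T hmu) hw) as hk.
  split; [apply Rinv_0_lt_compat; lra|].
  rewrite <- Rinv_1; apply Rinv_lt_contravar; lra.
Qed.

Lemma degree_decreasing (mu Ti w w' T : R) :
  0 < mu -> 0 < w -> w < w' -> degree mu Ti w' T < degree mu Ti w T.
Proof.
  intros hmu hw hww; rewrite !degree_eq.
  pose proof (degree_slope_pos mu Ti T hmu) as hk.
  apply Rinv_lt_contravar; [apply Rmult_lt_0_compat|]; nra.
Qed.

Lemma saha_degree (mu Ti ai a p T : R) :
  0 < mu -> 0 < ai -> 0 < a ->
  p = saha_pressure mu Ti ai a T -> ai = degree mu Ti (p * a / (1 + a)) T.
Proof.
  intros hmu hai ha ->; unfold degree, saha_pressure.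
  pose proof (Rpower_pos T (5 / 2)).
  replace (- Ti / T) with (- (Ti / T)) by (unfold Rdiv; ring).
  rewrite exp_Ropp.
  pose proof (exp_pos (Ti / T)).
  (* The factor (1 + a) / a of the pressure cancels against a / (1 + a), and the power and the
     exponential cancel as well. *)
  replace (mu * _ * _ / _) with ((1 - ai) / ai) by (field; lra).
  field; lra.
Qed.

(** * Change of coordinates between w and the pressure *)

(** The pressure is w / a + w, and both terms grow when w rises and a falls. *)
Lemma pressure_increasing (a w a' w' : R) :
  0 < a' -> a' < a -> 0 < w -> w < w' -> pressure a w < pressure a' w'.
Proof.
  intros ha haa hw hww; unfold pressure.
  replace (w * (1 + a) / a) with (w * / a + w) by (field; lra).
  replace (w' * (1 + a') / a') with (w' * / a' + w') by (field; lra).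
  assert (/ a < / a') by (apply Rinv_lt_contravar; nra).
  assert (0 < / a) by (apply Rinv_0_lt_compat; lra).
  nra.
Qed.

(** Both degrees decrease in w, hence so does their mean, and [pressure_increasing] makes the
    pressure strictly monotone in w. *)
Lemma pressure_injective (muA muB beta TA TB w w' T : R) :
  0 < muA -> 0 < muB -> 0 < beta < 1 -> 0 < w -> 0 < w' ->
  let a z := mean_ionization beta (degree muA TA z T) (degree muB TB z T) in
  pressure (a w) w = pressure (a w') w' -> w = w'.
Proof.
  intros hA hB hb hw hw' a heq.
  assert (hlt : forall x y, 0 < x -> x < y -> pressure (a x) x < pressure (a y) y).
  { intros x y hx hxy.
    assert (hy : 0 < y) by lra.
    apply pressure_increasing; auto.
    - apply mean_ionization_bounds; auto; apply degree_bounds; auto.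
    - unfold a, mean_ionization.
      pose proof (degree_decreasing muA TA x y T hA hx hxy).
      pose proof (degree_decreasing muB TB x y T hB hx hxy).
      nra. }
  destruct (Rtotal_order w w') as [h|[h|h]]; auto;
    apply hlt in h; auto; lra.
Qed.

Lemma degrees_of_ionization_explicit (muA muB beta TA TB : R)
    (alphaA alphaB : R -> R -> R) (p T : R) :
  0 < muA -> 0 < muB -> 0 < beta < 1 ->
  degrees_of_ionization muA muB beta TA TB alphaA alphaB -> 0 < p -> 0 < T ->
  exists w, 0 < w /\
    alphaA p T = degree muA TA w T /\ alphaB p T = degree muB TB w T /\
    p = pressure (mean_ionization beta (degree muA TA w T) (degree muB TB w T)) w.
Proof.
  intros hA hB hb hal hp hT.
  destruct (hal p T hp hT) as (bA & bB & sA & sB).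
  set (a := mean_ionization _ _ _) in *.
  assert (ha : 0 < a < 1) by (apply mean_ionization_bounds; auto).
  apply saha_degree in sA, sB; try lra.
  exists (p * a / (1 + a)).
  rewrite <- sA, <- sB; fold a; unfold pressure.
  repeat split; auto; [|field; lra].
  apply Rdiv_lt_0_compat; nra.
Qed.

(** The degrees at this p come from some w' with the same pressure, and injectivity forces w' = w.
    Thus [alphaA] and [alphaB] are known explicitly along any curve in the (w, T)-quadrant. *)
Lemma degrees_at_pressure (muA muB beta TA TB : R)
    (alphaA alphaB : R -> R -> R) (w T : R) :
  0 < muA -> 0 < muB -> 0 < beta < 1 ->
  degrees_of_ionization muA muB beta TA TB alphaA alphaB -> 0 < w -> 0 < T ->
  let p := pressure (mean_ionization beta (degree muA TA w T) (degree muB TB w T)) w in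
  0 < p /\ alphaA p T = degree muA TA w T /\ alphaB p T = degree muB TB w T.
Proof.
  intros hA hB hb hal hw hT p.
  assert (ha : 0 < mean_ionization beta (degree muA TA w T) (degree muB TB w T) < 1)
    by (apply mean_ionization_bounds; auto; apply degree_bounds; auto).
  assert (hp : 0 < p) by (apply Rdiv_lt_0_compat; nra).
  destruct (degrees_of_ionization_explicit muA muB beta TA TB alphaA alphaB p T)
    as (w' & hw' & eA & eB & ep); auto.
  apply (pressure_injective muA muB beta TA TB w w' T) in ep; auto.
  subst w'; auto.
Qed.

(** * Derivatives along the exponential curves *)

(** Logarithmic differentiation of (1 - a) / a = mu w exp (Ti / T) / T^(5/2): the left side gives -
    a' / (a (1 - a)), the right side x - (5/2 + Ti / T) y. *)
Lemma is_derive_degree (mu Ti x y t : R) :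
  0 < mu ->
  let T := exp (y * t) in
  let a := degree mu Ti (exp (x * t)) T in
  is_derive (fun s => degree mu Ti (exp (x * s)) (exp (y * s))) t
    (- (a * (1 - a)) * (x - (5 / 2 + Ti / T) * y)).
Proof.
  intros hmu T a; unfold a, T, degree, Rpower.
  pose proof (exp_pos (y * t)).
  pose proof (exp_pos (5 / 2 * ln (exp (y * t)))).
  assert (0 < mu * exp (x * t) * exp (Ti / exp (y * t))).
  { repeat apply Rmult_lt_0_compat; auto; apply exp_pos. }
  auto_derive.
  - repeat split; auto; try lra.
    apply Rgt_not_eq, Rplus_lt_0_compat; [lra|].
    now apply Rdiv_lt_0_compat.
  - rewrite ?ln_exp in *.
    change (Ti * / exp (y * t)) with (Ti / exp (y * t)).
    (* With the exponentials made opaque, a rational identity remains. *)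
    generalize dependent (exp (Ti / exp (y * t))).
    generalize dependent (exp (5 / 2 * (y * t))).
    intros; field; lra.
Qed.

(* The derivatives of the degrees and of the pressure are those dictated by
   Saha's equations, with [x] and [y] the logarithmic derivatives of [w] and [T];
   the conclusion reads  M / (Rg T) (dh - v dp) = d eta. *)
Lemma is_derive_eta (beta TA TB x y t : R) (aA aB T : R -> R) :
  0 < beta < 1 -> 0 < aA t < 1 -> 0 < aB t < 1 -> 0 < T t ->
  let dA := - (aA t * (1 - aA t)) * (x - (5 / 2 + TA / T t) * y) in
  let dB := - (aB t * (1 - aB t)) * (x - (5 / 2 + TB / T t) * y) in
  let a := mean_ionization beta (aA t) (aB t) in
  let da := mean_ionization beta dA dB in
  is_derive aA t dA -> is_derive aB t dB -> is_derive T t (T t * y) ->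
  is_derive (fun s => eta beta TA TB (aA s) (aB s) (T s)) t
    (5 / 2 * (1 + a) * y
     + beta * (5 / 2 + TA / T t) * dA + (1 - beta) * (5 / 2 + TB / T t) * dB
     - ((1 + a) * x - da / a)).
Proof.
  intros hb bA bB hT dA dB a da iA iB iT.
  assert (ha : 0 < a < 1) by (apply mean_ionization_bounds; auto).
  unfold mean_ionization in a.
  unfold eta; auto_derive.
  - repeat split; try lra; try (eexists; eassumption); fold a; lra.
  - rewrite (Derive_eta _ _ _ iA), (Derive_eta _ _ _ iB),
      (Derive_eta _ _ _ iT).
    (* For each species, dA (1 + aA) / (aA (1 - aA)) = (1 + aA) ((5/2 + TA / T) y - x). The TA / T
       terms cancel, and the weighted sum leaves (1 + a) (5/2 y - x). *)
    unfold da, dA, dB, mean_ionization, a in *; field; lra.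
Qed.

(** The logarithmic derivative of w (1 + a) / a is x + da / (1 + a) - da / a. *)
Lemma is_derive_pressure (x t da : R) (a : R -> R) :
  0 < a t -> is_derive a t da ->
  is_derive (fun s => pressure (a s) (exp (x * s))) t
    (pressure (a t) (exp (x * t)) * (x - da / (a t * (1 + a t)))).
Proof.
  intros ha ia; unfold pressure; auto_derive.
  - repeat split; try lra; eexists; eassumption.
  - rewrite (Derive_eta _ _ _ ia); field; lra.
Qed.

Lemma is_derive_entropy_defect (Rg M muA muB beta TA TB x y : R)
    (alphaA alphaB S : R -> R -> R) (t : R) :
  0 < Rg -> 0 < M -> 0 < muA -> 0 < muB -> 0 < beta < 1 ->
  degrees_of_ionization muA muB beta TA TB alphaA alphaB ->
  is_specific_entropy (specific_enthalpy Rg M beta TA TB alphaA alphaB)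
    (specific_volume Rg M beta alphaA alphaB) S ->
  let T s := exp (y * s) in
  let aA s := degree muA TA (exp (x * s)) (T s) in
  let aB s := degree muB TB (exp (x * s)) (T s) in
  let p s := pressure (mean_ionization beta (aA s) (aB s)) (exp (x * s)) in
  is_derive (fun s => M / Rg * S (p s) (T s) - eta beta TA TB (aA s) (aB s) (T s))
    t 0.
Proof.
  intros hR hM hA hB hb hal hS T aA aB p.
  assert (hT : forall s, 0 < T s) by (intro; apply exp_pos).
  assert (hdeg : forall s,
    0 < p s /\ alphaA (p s) (T s) = aA s /\ alphaB (p s) (T s) = aB s)
    by (intro; apply degrees_at_pressure; auto; apply exp_pos).
  assert (bA : 0 < aA t < 1) by (apply degree_bounds; auto; apply exp_pos).
  assert (bB : 0 < aB t < 1) by (apply degree_bounds; auto; apply exp_pos).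
  pose proof (mean_ionization_bounds beta _ _ hb bA bB) as ba.
  assert (iA : is_derive aA t
    (- (aA t * (1 - aA t)) * (x - (5 / 2 + TA / T t) * y)))
    by exact (is_derive_degree muA TA x y t hA).
  assert (iB : is_derive aB t
    (- (aB t * (1 - aB t)) * (x - (5 / 2 + TB / T t) * y)))
    by exact (is_derive_degree muB TB x y t hB).
  assert (iT : is_derive T t (T t * y)) by (unfold T; auto_derive; [easy|ring]).
  pose proof (is_derive_eta beta TA TB x y t aA aB T hb bA bB (hT t) iA iB iT) as iE.
  set (dA := - (aA t * _) * _) in *.
  set (dB := - (aB t * _) * _) in *.
  set (a := fun s => mean_ionization beta (aA s) (aB s)).
  set (da := mean_ionization beta dA dB).
  assert (ia : is_derive a t da).
  { unfold a, da, mean_ionization.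
    auto_derive; [repeat split; eexists; eassumption|].
    rewrite (Derive_eta _ _ _ iA), (Derive_eta _ _ _ iB); ring. }
  pose proof (is_derive_pressure x t da a (proj1 ba) ia) as ip.
  fold (p t) in ip; change (is_derive p t (p t * (x - da / (a t * (1 + a t))))) in ip.
  destruct (hdeg t) as (hp & eA & eB).
  destruct (hS (p t) (T t) hp (hT t)) as (Sp & ST & dS & dh).
  pose proof (derivable_pt_lim_comp_2d _ _ _ _ _ _ _ _ dS
    (proj1 (is_derive_Reals _ _ _) ip) (proj1 (is_derive_Reals _ _ _) iT)) as iS.
  pose proof (derivable_pt_lim_comp_2d _ _ _ _ _ _ _ _ dh
    (proj1 (is_derive_Reals _ _ _) ip) (proj1 (is_derive_Reals _ _ _) iT)) as ih.
  apply is_derive_Reals in iS, ih.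
  (* Along the curve the enthalpy is an explicit function of t. Its derivative must equal the one
     that the chain rule gives from dh = T dS + v dp, which determines dS. *)
  assert (ih' : is_derive
    (fun s => specific_enthalpy Rg M beta TA TB alphaA alphaB (p s) (T s)) t
    (Rg / M * T t * (5 / 2 * (1 + a t) * y
     + beta * (5 / 2 + TA / T t) * dA + (1 - beta) * (5 / 2 + TB / T t) * dB))).
  { apply (is_derive_ext (fun s => 5 * Rg * T s / (2 * M) * (1 + a s)
      + Rg / M * (beta * TA * aA s + (1 - beta) * TB * aB s))).
    { intro s; unfold specific_enthalpy, a.
      now destruct (hdeg s) as (_ & -> & ->). }
    auto_derive; [repeat split; eexists; eassumption|].
    rewrite (Derive_eta _ _ _ iA), (Derive_eta _ _ _ iB),
      (Derive_eta _ _ _ iT), (Derive_eta _ _ _ ia).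
    unfold da, mean_ionization.
    specialize (hT t); field; lra. }
  pose proof (eq_trans (eq_sym (is_derive_unique _ _ _ ih'))
    (is_derive_unique _ _ _ ih)) as e.
  unfold specific_volume in e; rewrite eA, eB in e.
  change (mean_ionization beta (aA t) (aB t)) with (a t) in *.
  fold da in iE.
  set (dS' := Sp * _ + ST * _) in iS.
  assert (edS : M / Rg * dS' = 5 / 2 * (1 + a t) * y
     + beta * (5 / 2 + TA / T t) * dA + (1 - beta) * (5 / 2 + TB / T t) * dB
     - ((1 + a t) * x - da / a t)).
  { specialize (hT t).
    (* Scaled by Rg T / M, the claim is T dS = dh - v dp, because v p = (Rg T / M) (1 + a). *)
    apply (Rmult_eq_reg_l (Rg / M * T t));
      [|apply Rgt_not_eq; repeat apply Rmult_lt_0_compat; auto;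
        now apply Rinv_0_lt_compat].
    rewrite Rmult_minus_distr_l, e; unfold dS'; field; lra. }
  rewrite <- edS in iE.
  rewrite <- (Rminus_diag (M / Rg * dS')).
  exact (is_derive_minus _ _ _ _ _ (is_derive_scal _ _ (M / Rg) _ iS) iE).
Qed.

(** * Constancy of the entropy defect *)

Theorem theorem1 (Rg M muA muB beta TA TB : R)
  (hRg : 0 < Rg) (hM : 0 < M) (hmuA : 0 < muA) (hmuB : 0 < muB)
  (hbeta : 0 < beta < 1) (hTA : 0 < TA) (hTAB : TA < TB) (hTB : TB <= 2 * TA)
  (alphaA alphaB : R -> R -> R)
  (halpha : degrees_of_ionization muA muB beta TA TB alphaA alphaB)
  (S : R -> R -> R)
  (hS : is_specific_entropy
          (specific_enthalpy Rg M beta TA TB alphaA alphaB)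
          (specific_volume Rg M beta alphaA alphaB) S) :
  exists const : R, forall p T : R, 0 < p -> 0 < T ->
    let aA := alphaA p T in
    let aB := alphaB p T in
    M / Rg * S p T =
      ln (beta * aA + (1 - beta) * aB)
      + beta * (ln aA - 2 * ln (1 - aA) + TA / T)
      + (1 - beta) * (ln aB - 2 * ln (1 - aB) + TB / T)
      + beta * (5 / 2 + TA / T) * aA
      + (1 - beta) * (5 / 2 + TB / T) * aB
      + const.
Proof.
  set (F := fun w T =>
    let aA := degree muA TA w T in
    let aB := degree muB TB w T in
    M / Rg * S (pressure (mean_ionization beta aA aB) w) T
    - eta beta TA TB aA aB T).
  (* The constant is the defect at the base point w = T = 1. *)
  exists (F 1 1); intros p T hp hT aA aB.
  destruct (degrees_of_ionization_explicit muA muB beta TA TB alphaA alphaB p T)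
    as (w & hw & eA & eB & ep); auto.
  assert (hF : F 1 1 = F w T).
  { set (G := fun t => F (exp (ln w * t)) (exp (ln T * t))).
    assert (hG : G 0 = G 1).
    { apply eq_is_derive; [|lra].
      intros t _; apply (is_derive_entropy_defect Rg M muA muB beta TA TB
        (ln w) (ln T) alphaA alphaB); auto. }
    unfold G in hG.
    now rewrite !Rmult_0_r, !Rmult_1_r, exp_0, !exp_ln in hG. }
  rewrite hF; unfold F, aA, aB; cbv zeta.
  rewrite <- ep, <- eA, <- eB; unfold eta; ring.
Qed.
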